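(* There is an algorithm $\mathcal{B}^w$ that, given a scoring vector $\vec\alpha=(\alpha_1,\dots,\alpha_m)$ and an instance $I=(C,V,\Pi,p,\mathbf{w})$ of weighted $\mathcal{R}_{\vec\alpha}$-shift-bribery with $|C|=m$, outputs a successful shift-action $\mathbf{t}$ for $I$ that satisfies $\Pi(\mathbf{t})\le 2\,\mathrm{opt}(I)$, and runs in time $\mathrm{poly}(|I|,|\vec\alpha|)$.
   Context: $\mathbb{Z}^+$ denotes the set of all nonnegative integers. A weighted election consists of a set $C$ of $m$ candidates, a list $V=(v^1,\dots,v^n)$ of voters, each voter $v^i$ being a strict linear order $\succ^i$ over $C$, and a vector of voter weights $\mathbf{w}=(w_1,\dots,w_n)$ (nonnegative integers); the vote of $v^i$ is interpreted as $w_i$ identical votes. Scoring rule $\mathcal{R}_{\vec\alpha}$: $\vec\alpha=(\alpha_1,\dots,\alpha_m)$ with $\alpha_j\in\mathbb{Z}^+$ for all $j$ and $\alpha_1\ge\dots\ge\alpha_m$. Each candidate receives $\alpha_j$ points from each vote ranking it in position $j$ (position 1 is the top), hence $w_i\alpha_j$ points from voter $v^i$ if $v^i$ ranks it in position $j$; the winners are all candidates with the maximum total score (ties allowed). Weighted $\mathcal{R}$-shift-bribery: an instance is $I=(C,V,\Pi,p,\mathbf{w})$ where $C=\{p,c_1,\dots,c_{m-1}\}$, $V=(v^1,\dots,v^n)$ is a list of linear orders over $C$, $\mathbf{w}$ is the vector of weights, $p\in C$ is the designated candidate, and $\Pi=(\pi^1,\dots,\pi^n)$ is a list of cost functions $\pi^i:\mathbb{Z}^+\to\mathbb{Z}^+$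 with $\pi^i(0)=0$, $\pi^i(k)\le\pi^i(k+1)$ for all $k$, and $\pi^i(s)=\pi^i(t-1)$ for all $s\ge t$, where $t$ is the position of $p$ in $\succ^i$. A shift-action is $\mathbf{t}=(t_1,\dots,t_n)\in(\mathbb{Z}^+)^n$; its cost is $\Pi(\mathbf{t})=\sum_{i=1}^n\pi^i(t_i)$. Applying it moves $p$ upwards by $t_i$ positions in the $i$-th voter's order for each $i$ (or to the top if fewer than $t_i$ candidates are above $p$), leaving the relative order of the other candidates and the weights unchanged. It is successful for $I$ if $p$ is a winner of the resulting weighted election. $\mathrm{opt}(I)$ is the minimum of $\Pi(\mathbf{t})$ over successful shift-actions $\mathbf{t}$. $|I|$ is the representation size of $I$ with all entries of $\Pi$ and $\mathbf{w}$ written in binary; $|\vec\alpha|$ is the number of bits in the binary encoding of $\vec\alpha$. *)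

(* Defs.v *)
From mathcomp Require Import all_boot.
From mathcomp Require Import boolp.

Set Implicit Arguments.
Unset Strict Implicit.
Unset Printing Implicit Defensive.

(** * Weighted elections and scoring rules *)

(* A strict linear order over the m candidates 'I_m, listed from the most to
   the least preferred one. The position of c in v is [(index c v).+1]. *)
Record vote (m : nat) := Vote {
  ranking :> m.-tuple 'I_m;
  ranking_uniq : uniq ranking
}.

Lemma mem_vote (m : nat) (v : vote m) (c : 'I_m) : c \in ranking v.
Proof.
have /card_uniqP sz := ranking_uniq v.
have /subset_cardP : #|ranking v| = #|'I_m| by rewrite sz size_tuple card_ord.
by move=> /(_ (subset_predT _)) ->.
Qed.

Lemma index_vote (m : nat) (v : vote m) (c : 'I_m) : index c v < m.
Proof.
apply: (@leq_trans (size (ranking v))); last by rewrite size_tuple.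
by rewrite index_mem mem_vote.
Qed.

Record election (m n : nat) := Election {
  voter : 'I_n -> vote m;
  weight : 'I_n -> nat
}.

Record scoring_vector (m : nat) := ScoringVector {
  scores :> m.-tuple nat;
  scores_sorted : sorted geq scores
}.

Section Scoring.
Variables (m n : nat) (alpha : scoring_vector m) (E : election m n).

Definition score (c : 'I_m) : nat :=
  \sum_(i < n) weight E i * nth 0 alpha (index c (voter E i)).

Definition winner (c : 'I_m) : Prop := forall d : 'I_m, score d <= score c.

End Scoring.

(** * Shift-bribery *)

Definition shift_up (T : eqType) (p : T) (k : nat) (s : seq T) : seq T :=
  let j := index p s - k in take j (rem p s) ++ p :: drop j (rem p s).

Lemma perm_shift_up (T : eqType) (p : T) (k : nat) (s : seq T) :
  p \in s -> perm_eq (shift_up p k s) s.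
Proof.
move=> ps; rewrite /shift_up perm_catC /= perm_sym.
apply: perm_trans (perm_to_rem ps) _.
by rewrite perm_cons perm_sym perm_catC cat_take_drop.
Qed.

Lemma size_shift_vote (m : nat) (p : 'I_m) (k : nat) (v : vote m) :
  size (shift_up p k v) == m.
Proof. by rewrite (perm_size (perm_shift_up k (mem_vote v p))) size_tuple. Qed.

Lemma uniq_shift_vote (m : nat) (p : 'I_m) (k : nat) (v : vote m) :
  uniq (Tuple (size_shift_vote p k v)).
Proof.
by rewrite /= (perm_uniq (perm_shift_up k (mem_vote v p))) ranking_uniq.
Qed.

Definition shift_vote (m : nat) (p : 'I_m) (k : nat) (v : vote m) : vote m :=
  Vote (uniq_shift_vote p k v).

(* With t = (index p v).+1 the position of the designated candidate p in the
   vote v, the condition s >= t reads [index p v < s], and t - 1 is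
   [index p v]. *)
Record instance (m n : nat) := Instance {
  elec :> election m n;
  designated : 'I_m;
  price : 'I_n -> nat -> nat;
  price0 : forall i, price i 0 = 0;
  price_leS : forall i k, price i k <= price i k.+1;
  price_top : forall i s, index designated (voter elec i) < s ->
    price i s = price i (index designated (voter elec i))
}.

Section ShiftBribery.
Variables (m n : nat) (alpha : scoring_vector m) (I : instance m n).

Definition shift_action := n.-tuple nat.

Definition cost (t : shift_action) : nat := \sum_(i < n) price I i (tnth t i).

Definition shifted (t : shift_action) : election m n :=
  Election (fun i => shift_vote (designated I) (tnth t i) (voter I i))
           (weight I).

Definition successful (t : shift_action) : Prop :=
  winner alpha (shifted t) (designated I).

(* Shifting p to the top of every vote always succeeds, so that the minimum
   below is over a nonempty set. *)
Lemma successful_top : successful [tuple m | _ < n].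
Proof.
move=> d; apply: leq_sum => i _ /=; rewrite leq_mul2l; apply/orP; right.
rewrite tnth_mktuple.
have -> : index (designated I) (shift_up (designated I) m (voter I i)) = 0.
  have /ltnW := index_vote (voter I i) (designated I).
  by rewrite /shift_up -subn_eq0 => /eqP -> /=; rewrite take0 /= eqxx.
have jm := index_vote (shift_vote (designated I) m (voter I i)) d.
have geq_trans : transitive geq by move=> x y z /= xy zx; exact: leq_trans zx xy.
apply: (sorted_leq_nth geq_trans leqnn 0 (scores_sorted alpha)) => //;
  by rewrite inE size_tuple // (leq_ltn_trans _ jm).
Qed.

Lemma opt_exists :
  exists k, `[< exists2 t : shift_action, successful t & cost t = k >].
Proof.
exists (cost [tuple m | _ < n]); apply/asboolP.
by exists [tuple m | _ < n] => //; exact: successful_top.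
Qed.

Definition opt : nat := ex_minn opt_exists.

End ShiftBribery.

(** * Algorithms and running time *)

(* Programs compute on binary trees with natural numbers at the leaves. The
   size of a tree counts its inner nodes and the bits of the binary
   representation of its leaves. *)
Inductive val := Num (k : nat) | Pair (a b : val).

Definition bits (k : nat) : nat := (trunc_log 2 k).+1.

Fixpoint vsize (x : val) : nat :=
  match x with
  | Num k => bits k
  | Pair a b => (vsize a + vsize b).+1
  end.

Inductive prim :=
  | Id | Const (k : nat) | Fst | Snd | IsNum | Add | Sub | Mul | Div.

Definition arith (op : nat -> nat -> nat) (x : val) : val :=
  if x is Pair (Num a) (Num b) then Num (op a b) else Num 0.

Definition prim_sem (o : prim) (x : val) : val :=
  match o with
  | Id => x
  | Const k => Num k
  | Fst => if x is Pair a _ then a else Num 0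
  | Snd => if x is Pair _ b then b else Num 0
  | IsNum => if x is Num _ then Num 1 else Num 0
  | Add => arith addn x
  | Sub => arith subn x
  | Mul => arith muln x
  | Div => arith divn x
  end.

Inductive prog :=
  | Prim (o : prim)
  | Seq (f g : prog)
  | Fork (f g : prog)
  | If (c f g : prog)
  | While (c f : prog).

Definition truth (x : val) : bool := if x is Num 0 then false else true.

(* [runs f x s y]: started on x, the program f halts with output y after time
   s. Costs are logarithmic: every step is charged at least the number of bits
   of the data it reads and writes, so that s is polynomially related to the
   number of steps of a Turing machine performing the same computation. *)
Inductive runs : prog -> val -> nat -> val -> Prop :=
  | runs_prim o x :
      runs (Prim o) x (vsize x + vsize (prim_sem o x)) (prim_sem o x)
  | runs_seq f g x y z s t :
      runs f x s y -> runs g y t z ->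
      runs (Seq f g) x (vsize x + s + t) z
  | runs_fork f g x y z s t :
      runs f x s y -> runs g x t z ->
      runs (Fork f g) x (vsize x + s + t + vsize (Pair y z)) (Pair y z)
  | runs_if_true c f g x b y s t :
      runs c x s b -> truth b -> runs f x t y ->
      runs (If c f g) x (vsize x + s + t) y
  | runs_if_false c f g x b y s t :
      runs c x s b -> ~~ truth b -> runs g x t y ->
      runs (If c f g) x (vsize x + s + t) y
  | runs_while_true c f x b y z s t u :
      runs c x s b -> truth b -> runs f x t y -> runs (While c f) y u z ->
      runs (While c f) x (vsize x + s + t + u) z
  | runs_while_false c f x b s :
      runs c x s b -> ~~ truth b ->
      runs (While c f) x (vsize x + s) x.

Local Ltac clash :=
  match goal with
  | A : is_true (truth ?b), B : is_true (~~ truth ?b) |- _ => by rewrite A in B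
  end.

Lemma runs_det f x s y s' y' :
  runs f x s y -> runs f x s' y' -> s = s' /\ y = y'.
Proof.
move=> H; elim: H s' y' => {f x s y}.
- by move=> o x s' y' H; inversion H; subst.
- move=> f g x y z s t _ IHf _ IHg s' y' H; inversion H; subst.
  have [? ?] := IHf _ _ ltac:(eassumption); subst.
  by have [? ?] := IHg _ _ ltac:(eassumption); subst.
- move=> f g x y z s t _ IHf _ IHg s' y' H; inversion H; subst.
  have [? ?] := IHf _ _ ltac:(eassumption); subst.
  by have [? ?] := IHg _ _ ltac:(eassumption); subst.
- move=> c f g x b y s t _ IHc Hb _ IHf s' y' H; inversion H; subst;
    have [? ?] := IHc _ _ ltac:(eassumption); subst.
  + by have [? ?] := IHf _ _ ltac:(eassumption); subst.
  + clash.
- move=> c f g x b y s t _ IHc Hb _ IHf s' y' H; inversion H; subst;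
    have [? ?] := IHc _ _ ltac:(eassumption); subst.
  + clash.
  + by have [? ?] := IHf _ _ ltac:(eassumption); subst.
- move=> c f x b y z s t u _ IHc Hb _ IHf _ IHw s' y' H; inversion H; subst;
    have [? ?] := IHc _ _ ltac:(eassumption); subst.
  + have [? ?] := IHf _ _ ltac:(eassumption); subst.
    by have [? ?] := IHw _ _ ltac:(eassumption); subst.
  + clash.
- move=> c f x b s _ IHc Hb s' y' H; inversion H; subst;
    have [? ?] := IHc _ _ ltac:(eassumption); subst => //.
  clash.
Qed.

(** * Representation of inputs and outputs *)

(* The list [:: x1; ...; xk] is Pair x1 (Pair x2 ... (Pair xk (Num 0))). *)
Definition enc_seq (T : Type) (enc : T -> val) (s : seq T) : val :=
  foldr (fun x r => Pair (enc x) r) (Num 0) s.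

Definition enc_scoring (m : nat) (alpha : scoring_vector m) : val :=
  enc_seq Num alpha.

Definition enc_vote (m : nat) (v : vote m) : val :=
  enc_seq (fun c : 'I_m => Num c) v.

(* A cost function is given by its values at 0, ..., t - 1, where t is the
   position of p in the vote: these determine it by [price_top]. *)
Definition enc_price (m n : nat) (I : instance m n) (i : 'I_n) : val :=
  enc_seq (fun k => Num (price I i k))
    (iota 0 (index (designated I) (voter I i)).+1).

(* (C, V, Pi, p, w) *)
Definition enc_instance (m n : nat) (I : instance m n) : val :=
  Pair (enc_seq (fun c : 'I_m => Num c) (enum 'I_m))
 (Pair (enc_seq (fun i => enc_vote (voter I i)) (enum 'I_n))
 (Pair (enc_seq (enc_price I) (enum 'I_n))
 (Pair (Num (designated I))
       (enc_seq (fun i => Num (weight I i)) (enum 'I_n))))).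

Definition enc_action (n : nat) (t : shift_action n) : val := enc_seq Num t.

Definition scoring_size (m : nat) (alpha : scoring_vector m) : nat :=
  vsize (enc_scoring alpha).

Definition instance_size (m n : nat) (I : instance m n) : nat :=
  vsize (enc_instance I).

(* Main.v *)
From mathcomp Require Import all_boot zify boolp.
Require Import Defs.

(* Guess the voter i0 whose shift k0 is the most expensive one of an optimal
   action t, perform this shift, and from then on use only shifts of cost at
   most cap, the cost of k0. While p is not a winner, change the shift of one
   voter so that p gains points at the best ratio of cost to points. Of the outcomes of
   the polynomially many guesses, the cheapest successful one is returned.

   For some slope l >= 0, every state u of this greedy procedure minimises
   cost - l * points voter by voter. Suppose that some d still beats p in u.
   Going from u to the join u \/ t, p gains at least what d loses, and d loses
   at least what it loses from u to t; as p beats d in t, this gives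
   2 points(u) < points(u \/ t) + points(t). By minimality of u against t and
   u \/ t, 2 cost(u) <= cost(t) + cost(u \/ t), that is,
   cost(u) + cost(u /\ t) <= 2 cost(t). The meet u /\ t contains the guessed
   shift, so cost(u) + cap <= 2 cost(t), and the next step, of cost at most
   cap, does not exceed 2 cost(t). *)

Set Implicit Arguments.
Unset Strict Implicit.
Unset Printing Implicit Defensive.

(** * Polynomial-time functions *)

Lemma ltn_exp_bits k : k < 2 ^ bits k. Proof. exact: trunc_log_ltn. Qed.

Lemma bits_leq k s : 0 < s -> k < 2 ^ s -> bits k <= s.
Proof.
case: s => // s _; rewrite /bits ltnS; case: k => [|k]; first by rewrite trunc_log0.
move=> lt_k; rewrite -ltnS -(ltn_exp2l _ _ (isT : 1 < 2)).
exact: leq_ltn_trans (trunc_logP _ _) lt_k.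
Qed.

Lemma leq_bits : {homo bits : k l / k <= l}.
Proof. by move=> k l /(leq_trunc_log 2); rewrite /bits ltnS. Qed.

Lemma bits_leqS k : bits k <= k.+1.
Proof. by apply: bits_leq => //; exact: ltnW (ltn_expl _ _). Qed.

Lemma bitsD k l : bits (k + l) <= bits k + bits l.
Proof.
apply: bits_leq => //; apply: (@leq_trans (k.+1 * l.+1)); first by nia.
by rewrite expnD leq_mul // ltn_exp_bits.
Qed.

Lemma bitsM k l : bits (k * l) <= bits k + bits l.
Proof.
apply: bits_leq => //; apply: (@leq_trans (k.+1 * l.+1)); first by nia.
by rewrite expnD leq_mul // ltn_exp_bits.
Qed.

Lemma vsize_gt0 x : 0 < vsize x. Proof. by case: x. Qed.

Lemma runs_vsize f x s y : runs f x s y -> vsize y <= s.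
Proof. by elim=> *; lia. Qed.

(** Encodings are inferred from types, so that programs can be handled as ordinary functions between
    encoded types. *)
Class Enc (T : Type) := enc : T -> val.
Arguments enc : simpl never.
Arguments vsize : simpl never.
#[local] Instance enc_nat : Enc nat := Num.
(** [false] becomes [Num 0], the only value that [truth] rejects, so a boolean function can serve
    directly as the test of an [If] or a [While]. *)
#[local] Instance enc_bool : Enc bool := fun b => Num b.
#[local] Instance enc_prod T U {eT : Enc T} {eU : Enc U} : Enc (T * U) :=
  fun x => Pair (enc x.1) (enc x.2).
#[local] Instance enc_list T {eT : Enc T} : Enc (seq T) := enc_seq enc.

Definition pbd A {eA : Enc A} (s : A -> nat) :=
  exists c d, forall a, s a <= c * vsize (enc a) ^ d.

(* An inductive type, lest unification unfold it. *)
Inductive poly A T {eA : Enc A} {eT : Enc T} (f : A -> T) : Prop :=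
  Poly of exists B s, pbd s /\
    forall a, exists2 t, runs B (enc a) t (enc (f a)) & t <= s a.

Section Bounds.
Context {A : Type} {eA : Enc A}.
Implicit Types s t : A -> nat.

Lemma pbd_leq s t : (forall a, s a <= t a) -> pbd t -> pbd s.
Proof. by move=> st [c [d H]]; exists c, d => a; apply: leq_trans (H a). Qed.

Lemma pbd_cst k : pbd (fun _ : A => k).
Proof. by exists k, 0 => a; rewrite muln1. Qed.

Lemma pbd_id : pbd (fun a : A => vsize (enc a)).
Proof. by exists 1, 1 => a; rewrite mul1n. Qed.

(** Sizes are positive, so raising an exponent never decreases a power. Hence the single monomial of
    degree [d + d'] absorbs both summands. *)
Lemma pbdD s t : pbd s -> pbd t -> pbd (fun a => s a + t a).
Proof.
move=> [c [d H]] [c' [d' H']]; exists (c + c'), (d + d') => a.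
rewrite mulnDl; apply: leq_add.
  by apply: leq_trans (H a) _; rewrite leq_mul2l leq_pexp2l ?vsize_gt0 ?leq_addr ?orbT.
by apply: leq_trans (H' a) _; rewrite leq_mul2l leq_pexp2l ?vsize_gt0 ?leq_addl ?orbT.
Qed.

Lemma pbdM s t : pbd s -> pbd t -> pbd (fun a => s a * t a).
Proof.
move=> [c [d H]] [c' [d' H']]; exists (c * c'), (d + d') => a.
by rewrite expnD mulnACA leq_mul.
Qed.

Lemma pbdS s : pbd s -> pbd (fun a => (s a).+1).
Proof.
by move=> /pbdD /(_ (pbd_cst 1)); apply: pbd_leq => a; rewrite addn1.
Qed.

Lemma pbdX s d : pbd s -> pbd (fun a => s a ^ d).
Proof.
move=> Hs; elim: d => [|d IH]; first exact: pbd_cst.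
by apply: pbd_leq (pbdM Hs IH) => a; rewrite expnS.
Qed.

(** Producing an output is charged at least its size, so the time bound also bounds the size of the
    result. This is what makes composition polynomial. *)
Lemma pbd_poly T {eT : Enc T} (f : A -> T) : poly f -> pbd (fun a => vsize (enc (f a))).
Proof.
move=> [[B [s [Hs H]]]]; apply: pbd_leq Hs => a.
by have [t /runs_vsize] := H a; exact: leq_trans.
Qed.

Lemma pbd_trans T {eT : Enc T} (f : A -> T) s (g : T -> nat) :
  pbd s -> (forall a, vsize (enc (f a)) <= s a) -> pbd g -> pbd (g \o f).
Proof.
move=> Hs fs [c [d H]]; apply: (@pbd_leq _ (fun a => c * s a ^ d)).
  move=> a /=; apply: leq_trans (H _) _; rewrite leq_mul2l.
  by clear H; case: d => [|d]; rewrite ?expn0 ?leq_exp2r ?fs ?orbT.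
by apply: pbdM; [exact: pbd_cst | exact: pbdX].
Qed.

Lemma pbd_comp T {eT : Enc T} (f : A -> T) (g : T -> nat) :
  poly f -> pbd g -> pbd (g \o f).
Proof. by move=> /pbd_poly Hf; apply: (pbd_trans Hf). Qed.

End Bounds.

(** * Closure under composition, branching and arithmetic *)

Section Combinators.
Context {A : Type} {eA : Enc A}.

Lemma poly_comp T U {eT : Enc T} {eU : Enc U} (f : A -> T) (g : T -> U) :
  poly f -> poly g -> poly (fun a => g (f a)).
Proof.
move=> Hf [[G [s' [Hs' HG]]]]; have [[F [s [Hs HF]]]] := Hf.
constructor; exists (Seq F G), (fun a => vsize (enc a) + s a + s' (f a)); split.
  by do !apply: pbdD => //; [exact: pbd_id | exact: pbd_comp].
move=> a; have [t rF lt] := HF a; have [u rG lu] := HG (f a).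
by exists (vsize (enc a) + t + u); [exact: runs_seq rF rG | rewrite !leq_add].
Qed.

Lemma poly_prim T {eT : Enc T} (f : A -> T) o :
  (forall a, prim_sem o (enc a) = enc (f a)) ->
  pbd (fun a => vsize (enc (f a))) -> poly f.
Proof.
move=> Hf Hs; constructor; exists (Prim o), (fun a => vsize (enc a) + vsize (enc (f a))).
split; first by apply: pbdD Hs; exact: pbd_id.
by move=> a; eexists; last exact: leqnn; rewrite -Hf; exact: runs_prim.
Qed.

Lemma poly_id : poly (fun a : A => a).
Proof. by apply: (@poly_prim _ _ _ Id) => //; exact: pbd_id. Qed.

Lemma poly_pair T U {eT : Enc T} {eU : Enc U} (f : A -> T) (g : A -> U) :
  poly f -> poly g -> poly (fun a => (f a, g a)).
Proof.
move=> Hf Hg; have [[F [s [Hs HF]]]] := Hf; have [[G [s' [Hs' HG]]]] := Hg.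
constructor; exists (Fork F G), (fun a => vsize (enc a) + s a + s' a + vsize (enc (f a, g a))).
split; first do !apply: pbdD => //; first exact: pbd_id.
  by apply: pbdS; apply: pbdD; exact: pbd_poly.
move=> a; have [t rF lt] := HF a; have [u rG lu] := HG a.
by eexists; [exact: runs_fork rF rG | rewrite !leq_add].
Qed.

(** A nonempty list is encoded as the pair of its head and its tail, so the program for pairs serves
    unchanged. *)
Lemma poly_cons T {eT : Enc T} (f : A -> T) (g : A -> seq T) :
  poly f -> poly g -> poly (fun a => f a :: g a).
Proof. by move=> Hf Hg; have [H] := poly_pair Hf Hg; constructor. Qed.

Lemma poly_fst T U {eT : Enc T} {eU : Enc U} (f : A -> T * U) :
  poly f -> poly (fun a => (f a).1).
Proof.
move=> Hf; apply: (poly_comp Hf (g := fst)).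
constructor; exists (Prim Fst), (fun x => vsize (enc x) + vsize (enc x)).
split; first by apply: pbdD; exact: pbd_id.
move=> [x y]; eexists; first exact: runs_prim.
by rewrite leq_add2l /=; exact: leqW (leq_addr _ _).
Qed.

Lemma poly_snd T U {eT : Enc T} {eU : Enc U} (f : A -> T * U) :
  poly f -> poly (fun a => (f a).2).
Proof.
move=> Hf; apply: (poly_comp Hf (g := snd)).
constructor; exists (Prim Snd), (fun x => vsize (enc x) + vsize (enc x)).
split; first by apply: pbdD; exact: pbd_id.
move=> [x y]; eexists; first exact: runs_prim.
by rewrite leq_add2l /=; exact: leqW (leq_addl _ _).
Qed.

(** [Const] yields only numbers; any other constant tree is assembled with [Fork], by induction on
    the tree. *)
Lemma poly_cst T {eT : Enc T} (x : T) : poly (fun _ : A => x).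
Proof.
have: exists B s, pbd s /\ forall a : A, exists2 t, runs B (enc a) t (enc x) & t <= s a.
  elim: (enc x) => [k|u [F [s [Hs HF]]] v [G [s' [Hs' HG]]]].
    exists (Prim (Const k)), (fun a => vsize (enc a) + bits k).
    split; first by apply: pbdD; [exact: pbd_id | exact: pbd_cst].
    by move=> a; eexists; first exact: runs_prim.
  exists (Fork F G), (fun a => vsize (enc a) + s a + s' a + vsize (Pair u v)).
  split; first by do !apply: pbdD => //; [exact: pbd_id | exact: pbd_cst].
  move=> a; have [t rF lt] := HF a; have [w rG lw] := HG a.
  by eexists; [exact: runs_fork rF rG | rewrite !leq_add].
by move=> [B [s H]]; constructor; exists B, s.
Qed.

Lemma poly_if T {eT : Enc T} (b : A -> bool) (f g : A -> T) :
  poly b -> poly f -> poly g -> poly (fun a => if b a then f a else g a).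
Proof.
move=> [[B [r [Hr HB]]]] [[F [s [Hs HF]]]] [[G [s' [Hs' HG]]]].
constructor; exists (If B F G), (fun a => vsize (enc a) + r a + (s a + s' a)).
split; first by do !apply: pbdD => //; exact: pbd_id.
move=> a; have [p rB lp] := HB a; have [t rF lt] := HF a; have [u rG lu] := HG a.
case: ifP => ba; rewrite ba in rB.
  exists (vsize (enc a) + p + t); first exact: runs_if_true rB _ rF.
  by rewrite !leq_add // (leq_trans lt) ?leq_addr.
exists (vsize (enc a) + p + u); first exact: runs_if_false rB _ rG.
by rewrite !leq_add // (leq_trans lu) ?leq_addl.
Qed.

(** The empty list is encoded by a number and every other list by a pair, so [IsNum] separates
    them. *)
Lemma poly_nilp T {eT : Enc T} (f : A -> seq T) : poly f -> poly (fun a => nilp (f a)).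
Proof.
move=> Hf; apply: (poly_comp Hf (g := @nilp T)).
constructor; exists (Prim IsNum), (fun x => vsize (enc x) + 1).
split; first by apply: pbdD; [exact: pbd_id | exact: pbd_cst].
by case=> [|x l]; eexists; try exact: runs_prim.
Qed.

Lemma poly_arith (op : nat -> nat -> nat) o (f g : A -> nat) :
  prim_sem o =1 arith op -> (forall k l, bits (op k l) <= bits k + bits l) ->
  poly f -> poly g -> poly (fun a => op (f a) (g a)).
Proof.
move=> Ho Hop Hf Hg; apply: (poly_comp (poly_pair Hf Hg) (g := fun x => op x.1 x.2)).
constructor; exists (Prim o), (fun x => vsize (enc x) + vsize (enc x)).
split; first by apply: pbdD; exact: pbd_id.
move=> [k l]; have E : prim_sem o (enc (k, l)) = enc (op k l) by rewrite Ho.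
exists (vsize (enc (k, l)) + vsize (enc (op k l))); first by rewrite -E; exact: runs_prim.
by rewrite leq_add2l; exact: leqW (Hop k l).
Qed.

Lemma poly_add (f g : A -> nat) : poly f -> poly g -> poly (fun a => f a + g a).
Proof. exact: (poly_arith (o := Add) _ bitsD). Qed.

Lemma poly_mul (f g : A -> nat) : poly f -> poly g -> poly (fun a => f a * g a).
Proof. exact: (poly_arith (o := Mul) _ bitsM). Qed.

Lemma poly_sub (f g : A -> nat) : poly f -> poly g -> poly (fun a => f a - g a).
Proof.
apply: (poly_arith (o := Sub)) => // k l.
by apply: leq_trans (leq_addr _ _); apply: leq_bits; exact: leq_subr.
Qed.

Lemma poly_not (b : A -> bool) : poly b -> poly (fun a => ~~ b a).
Proof. by move=> Hb; apply: (poly_if Hb (poly_cst false) (poly_cst true)). Qed.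

Lemma poly_and (b c : A -> bool) : poly b -> poly c -> poly (fun a => b a && c a).
Proof. by move=> Hb Hc; apply: (poly_if Hb Hc (poly_cst false)). Qed.

Lemma poly_or (b c : A -> bool) : poly b -> poly c -> poly (fun a => b a || c a).
Proof. by move=> Hb Hc; apply: (poly_if Hb (poly_cst true) Hc). Qed.

Lemma poly_ext T {eT : Enc T} (f g : A -> T) : f =1 g -> poly g -> poly f.
Proof.
by move=> fg [[B [s [Hs H]]]]; constructor; exists B, s; split=> // a; rewrite fg; exact: H.
Qed.

(* The truncated difference is the condition of an [If]: it is true if nonzero. *)
Lemma poly_leq (f g : A -> nat) : poly f -> poly g -> poly (fun a => f a <= g a).
Proof.
move=> Hf Hg; have [[B [r [Hr HB]]]] := poly_sub Hf Hg.
have [[F [s [Hs HF]]]] := poly_cst false; have [[G [s' [Hs' HG]]]] := poly_cst true.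
constructor; exists (If B F G), (fun a => vsize (enc a) + r a + (s a + s' a)).
split; first by do !apply: pbdD => //; exact: pbd_id.
move=> a; have [p rB lp] := HB a; have [t rF lt] := HF a; have [u rG lu] := HG a.
rewrite -[f a <= g a]/(f a - g a == 0); case: (f a - g a) rB => [|k] rB.
  exists (vsize (enc a) + p + u); first exact: runs_if_false rB _ rG.
  by rewrite !leq_add // (leq_trans lu) ?leq_addl.
exists (vsize (enc a) + p + t); first exact: runs_if_true rB _ rF.
by rewrite !leq_add // (leq_trans lt) ?leq_addr.
Qed.

Lemma poly_succ (f : A -> nat) : poly f -> poly (fun a => (f a).+1).
Proof.
move=> Hf; apply: poly_ext (poly_add Hf (poly_cst 1)) => a; by rewrite addn1.
Qed.

Lemma poly_eqn (f g : A -> nat) : poly f -> poly g -> poly (fun a => f a == g a).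
Proof.
move=> Hf Hg; apply: poly_ext (poly_and (poly_leq Hf Hg) (poly_leq Hg Hf)) => a.
by rewrite eqn_leq.
Qed.

End Combinators.

Ltac poly_base := repeat first
  [ assumption | exact: poly_id | exact: poly_cst | apply: poly_pair | apply: poly_cons
  | apply: poly_fst | apply: poly_snd | apply: poly_nilp | apply: poly_not
  | apply: poly_leq | apply: poly_eqn | apply: poly_if | apply: poly_succ | apply: poly_add
  | apply: poly_sub | apply: poly_mul | apply: poly_and | apply: poly_or ].

(** * Sizes of encoded data *)

Lemma vsize_pair T U {eT : Enc T} {eU : Enc U} (x : T) (y : U) :
  vsize (enc (x, y)) = (vsize (enc x) + vsize (enc y)).+1.
Proof. by []. Qed.

Lemma vsize_fst T U {eT : Enc T} {eU : Enc U} (x : T * U) : vsize (enc x.1) <= vsize (enc x).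
Proof. exact: leqW (leq_addr _ _). Qed.

Lemma vsize_snd T U {eT : Enc T} {eU : Enc U} (x : T * U) : vsize (enc x.2) <= vsize (enc x).
Proof. exact: leqW (leq_addl _ _). Qed.

Lemma vsize_cons T {eT : Enc T} (x : T) (s : seq T) :
  vsize (enc (x :: s)) = (vsize (enc x) + vsize (enc s)).+1.
Proof. by []. Qed.

Lemma vsize_seq T {eT : Enc T} (s : seq T) :
  vsize (enc s) = (\sum_(x <- s) (vsize (enc x)).+1).+1.
Proof.
elim: s => [|x s IH]; first by rewrite big_nil.
by rewrite big_cons vsize_cons IH; lia.
Qed.

Lemma size_vsize T {eT : Enc T} (s : seq T) : size s <= vsize (enc s).
Proof.
by rewrite vsize_seq; elim: s => [|x s IH]; rewrite ?big_nil ?big_cons //=; lia.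
Qed.

Lemma vsize_cat T {eT : Enc T} (s t : seq T) :
  vsize (enc (s ++ t)) <= vsize (enc s) + vsize (enc t).
Proof. by rewrite !vsize_seq big_cat /=; lia. Qed.

Lemma vsize_rev T {eT : Enc T} (s : seq T) : vsize (enc (rev s)) = vsize (enc s).
Proof.
rewrite !vsize_seq; congr _.+1; elim: s => // x s IH.
by rewrite rev_cons -cats1 big_cat /= !big_cons big_nil IH addn0 addnC.
Qed.

Lemma vsize_take T {eT : Enc T} (s : seq T) i : vsize (enc (take i s)) <= vsize (enc s).
Proof. by rewrite -{2}(cat_take_drop i s) !vsize_seq big_cat /= ltnS leq_addr. Qed.

Lemma vsize_drop T {eT : Enc T} (s : seq T) i : vsize (enc (drop i s)) <= vsize (enc s).
Proof. by rewrite -{2}(cat_take_drop i s) !vsize_seq big_cat /= ltnS leq_addl. Qed.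

Lemma vsize_seq_leq (s : seq nat) M :
  {in s, forall x, bits x <= M} -> vsize (enc s) <= (size s * M.+1).+1.
Proof.
rewrite vsize_seq ltnS; elim: s => [|x s IH] H; rewrite ?big_nil // big_cons mulSn.
apply: leq_add; first by rewrite ltnS H ?mem_head.
by apply: IH => y ys; rewrite H // inE ys orbT.
Qed.

(** The loop state consists of the parameter, the rest of the list and the accumulator. [M] bounds
    every state that occurs, so each of the [size l] rounds and the final test costs at most [M]
    plus the bounds of test and body taken at [M]. *)
Lemma while_foldl A T S {eA : Enc A} {eT : Enc T} {eS : Enc S}
    (step : A -> T -> S -> S) C B c d c' d' :
  (forall q : A * (seq T * S), exists2 t,
     runs C (enc q) t (enc (~~ nilp q.2.1)) & t <= c * vsize (enc q) ^ d) ->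
  (forall q : A * ((T * seq T) * S), exists2 t,
     runs B (enc q) t (enc (q.1, (q.2.1.2, step q.1 q.2.1.1 q.2.2))) &
     t <= c' * vsize (enc q) ^ d') ->
  forall a M l s,
    (forall i, vsize (enc (a, (drop i l, foldl (fun s x => step a x s) s (take i l)))) <= M) ->
  exists2 t,
    runs (While C B) (enc (a, (l, s))) t
      (enc (a, ([::] : seq T, foldl (fun s x => step a x s) s l))) &
    t <= (size l).+1 * (M + c * M ^ d + c' * M ^ d').
Proof.
move=> HC HB a M; have leX k e x : x <= M -> k * x ^ e <= k * M ^ e.
  by move=> xM; rewrite leq_mul2l; case: e => [|e]; rewrite ?expn0 ?leq_exp2r ?xM ?orbT.
elim=> [|x l IH] s HM.
  have [t rC lt] := HC (a, ([::], s)); exists (vsize (enc (a, ([::] : seq T, s))) + t).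
    exact: runs_while_false rC _.
  have := HM 0; rewrite drop0 take0 => HM0; rewrite mul1n.
  apply: leq_trans (leq_addr _ _); apply: leq_add => //.
  exact: leq_trans lt (leX _ _ _ HM0).
have [t rC lt] := HC (a, (x :: l, s)).
have [u rB lu] := HB (a, ((x, l), s)).
have [|w rW lw] := IH (step a x s); first by move=> i; exact: (HM i.+1).
have := HM 0; rewrite drop0 take0 => HM0.
exists (vsize (enc (a, (x :: l, s))) + t + u + w).
  exact: runs_while_true rC _ rB rW.
rewrite mulSn; apply: leq_add lw; apply: leq_add; first apply: leq_add => //.
  exact: leq_trans lt (leX _ _ _ HM0).
exact: leq_trans lu (leX _ _ _ HM0).
Qed.

(** * Folds and functions defined by them *)

Section Folds.
Context {A : Type} {eA : Enc A}.

(** A polynomial [step] alone is not enough: repeated squaring doubles the number of bits in each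
    round. Hence the bound [b] on all intermediate accumulators. *)
Lemma poly_foldl T S {eT : Enc T} {eS : Enc S}
    (step : A -> T -> S -> S) (l : A -> seq T) (z : A -> S) (b : A -> nat) :
  poly l -> poly z -> poly (fun q : A * T * S => step q.1.1 q.1.2 q.2) ->
  pbd b ->
  (forall a i, vsize (enc (foldl (fun s x => step a x s) (z a) (take i (l a)))) <= b a) ->
  poly (fun a => foldl (fun s x => step a x s) (z a) (l a)).
Proof.
move=> Hl Hz Hstep Hb Hbd.
have [[C [sC [[c [d Hs]] HC]]]] : poly (fun q : A * (seq T * S) => ~~ nilp q.2.1).
  by poly_base.
have [[B [sB [[c' [d' Hs']] HB]]]] : poly (fun q : A * ((T * seq T) * S) =>
    (q.1, (q.2.1.2, step q.1 q.2.1.1 q.2.2))).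
  do 2![apply: poly_pair; first by poly_base].
  apply: (poly_comp (f := fun q : A * ((T * seq T) * S) => ((q.1, q.2.1.1), q.2.2)) _ Hstep).
  by poly_base.
have [[I [r [Hr HI]]]] := poly_pair poly_id (poly_pair Hl Hz).
pose (M := fun a => (vsize (enc a) + (vsize (enc (l a)) + b a).+1).+1).
have HM : pbd M.
  by apply: pbdS; apply: pbdD; [exact: pbd_id | apply: pbdS; apply: pbdD => //; exact: pbd_poly].
pose (W := fun a => (size (l a)).+1 * (M a + c * M a ^ d + c' * M a ^ d')).
have HW : pbd W.
  apply: pbdM.
    by apply: pbdS; apply: pbd_leq (pbd_poly Hl) => a; exact: size_vsize.
  by do !apply: pbdD => //; apply: pbdM; (exact: pbd_cst || exact: pbdX).
(* [I] sets up the loop state, and the two projections extract the accumulator from the final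
   one. *)
constructor; exists (Seq I (Seq (While C B) (Seq (Prim Snd) (Prim Snd)))).
exists (fun a => vsize (enc a) + r a + (M a + W a + (M a + (M a + M a) + (M a + M a)))).
split; first by do !apply: pbdD => //; exact: pbd_id.
move=> a; have [t rI lt] := HI a; set res := foldl _ _ _.
have bnd i : vsize (enc (a, (drop i (l a),
    foldl (fun s x => step a x s) (z a) (take i (l a))))) <= M a.
  by rewrite /M !vsize_pair ltnS leq_add2l ltnS leq_add ?Hbd ?vsize_drop.
have [|||w rW lw] := @while_foldl _ _ _ _ _ _ step C B c d c' d' _ _ a (M a) (l a) (z a) => //.
- by move=> q; have [u ru lu] := HC q; exists u => //; exact: leq_trans lu (Hs q).
- by move=> q; have [u ru lu] := HB q; exists u => //; exact: leq_trans lu (Hs' q).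
have b0 := bnd 0; rewrite drop0 take0 /= in b0.
have bn := bnd (size (l a)); rewrite drop_size take_size -/res in bn.
have bS : vsize (enc ([::] : seq T, res)) <= M a.
  by apply: leq_trans bn; apply: leqW; exact: leq_addl.
have bR : vsize (enc res) <= M a.
  by apply: leq_trans bS; apply: leqW; exact: leq_addl.
eexists.
  apply: (runs_seq rI); apply: (runs_seq rW); apply: runs_seq; exact: runs_prim.
by rewrite !leq_add //=.
Qed.

Lemma poly_rev T {eT : Enc T} (l : A -> seq T) : poly l -> poly (fun a => rev (l a)).
Proof.
move=> Hl.
have E s : rev s = foldl (fun (r : seq T) x => x :: r) [::] s.
  by rewrite /rev; elim: s [::] => //= x s IH r; rewrite IH.
apply: poly_ext (fun a => E (l a)) _.
apply: (poly_foldl (step := fun _ x r => x :: r) (b := fun a => vsize (enc (l a)))) => //.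
- exact: poly_cst.
- by poly_base.
- exact: pbd_poly.
by move=> a i; rewrite -E vsize_rev; exact: vsize_take.
Qed.



(** A left fold over the reversed list. Its prefixes are the reversed suffixes of [l a], hence
    [drop] in the bound. *)
Lemma poly_foldr T S {eT : Enc T} {eS : Enc S}
    (step : A -> T -> S -> S) (l : A -> seq T) (z : A -> S) (b : A -> nat) :
  poly l -> poly z -> poly (fun q : A * T * S => step q.1.1 q.1.2 q.2) ->
  pbd b ->
  (forall a i, vsize (enc (foldr (step a) (z a) (drop i (l a)))) <= b a) ->
  poly (fun a => foldr (step a) (z a) (l a)).
Proof.
move=> Hl Hz Hstep Hb Hbd; apply: poly_ext (fun a => esym (foldl_rev _ _ _)) _.
apply: poly_foldl (poly_rev Hl) Hz Hstep Hb _ => a i.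
by rewrite take_rev foldl_rev.
Qed.

(** For every entry [x] of [l a], the pair [(a, x)] has size at most one more than the sizes of [a]
    and [l a] together, so one bound holds for all images. *)
Lemma poly_map T U {eT : Enc T} {eU : Enc U} (h : A -> T -> U) (l : A -> seq T) :
  poly l -> poly (fun q : A * T => h q.1 q.2) -> poly (fun a => [seq h a x | x <- l a]).
Proof.
move=> Hl Hh; have [c [d Hc]] := pbd_poly Hh.
pose (b := fun a => (vsize (enc (l a)) * (c * (vsize (enc a) + vsize (enc (l a))).+1 ^ d).+1).+1).
have bnd a s : vsize (enc s) <= vsize (enc (l a)) ->
    vsize (enc [seq h a x | x <- s]) <=
      (size s * (c * (vsize (enc a) + vsize (enc (l a))).+1 ^ d).+1).+1.
  elim: s => // x s IH; rewrite /= mulSn !vsize_cons => lt_s.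
  have le_h : vsize (enc (h a x)) <= c * (vsize (enc a) + vsize (enc (l a))).+1 ^ d.
    apply: leq_trans (Hc (a, x)) _; rewrite leq_mul2l.
    have le_ax : vsize (enc (a, x)) <= (vsize (enc a) + vsize (enc (l a))).+1.
      by rewrite vsize_pair; lia.
    by case: (d) => [|e]; rewrite ?expn0 ?leq_exp2r ?le_ax ?orbT.
  have IHs := IH (leq_trans (leqW (leq_addl _ _)) lt_s).
  by rewrite ltnS addSnnS leq_add.
apply: (poly_foldr (step := fun a x r => h a x :: r) (b := b)) => //.
- exact: poly_cst.
- apply: poly_cons; last by poly_base.
  by apply: (poly_comp (f := fun q : A * T * seq U => q.1) _ Hh); poly_base.
- apply: pbdS; apply: pbdM; first exact: pbd_poly.
  apply: pbdS; apply: pbdM; first exact: pbd_cst.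
  by apply: pbdX; apply: pbdS; apply: pbdD; [exact: pbd_id | exact: pbd_poly].
move=> a i; have le_i : vsize (enc (drop i (l a))) <= vsize (enc (l a)) by exact: vsize_drop.
rewrite -[foldr _ _ _]/(map (h a) (drop i (l a))).
apply: (leq_trans (bnd a _ le_i)); rewrite /b ltnS leq_mul2r.
by rewrite (leq_trans (size_vsize _) le_i) orbT.
Qed.

Lemma poly_sumn (l : A -> seq nat) : poly l -> poly (fun a => sumn (l a)).
Proof.
move=> Hl; apply: (poly_foldr (step := fun _ x r => x + r) (b := fun a => vsize (enc (l a)))) => //.
- exact: poly_cst.
- by poly_base.
- exact: pbd_poly.
move=> a i; apply: leq_trans (vsize_drop _ i); elim: (drop _ _) => // x s IH.
by apply: leq_trans (bitsD _ _) _; apply: leqW; rewrite leq_add2l.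
Qed.

Lemma poly_sum T {eT : Enc T} (F : A -> T -> nat) (l : A -> seq T) :
  poly l -> poly (fun q : A * T => F q.1 q.2) -> poly (fun a => \sum_(x <- l a) F a x).
Proof.
move=> Hl HF; apply: poly_ext (poly_sumn (poly_map Hl HF)) => a.
by rewrite sumnE big_map.
Qed.

Lemma poly_size T {eT : Enc T} (l : A -> seq T) : poly l -> poly (fun a => size (l a)).
Proof.
move=> Hl; apply: poly_ext (poly_sum (F := fun _ _ => 1) Hl (poly_cst 1)) => a.
by rewrite sum1_size.
Qed.

Lemma poly_all T {eT : Enc T} (P : A -> T -> bool) (l : A -> seq T) :
  poly l -> poly (fun q : A * T => P q.1 q.2) -> poly (fun a => all (P a) (l a)).
Proof.
move=> Hl HP.
have E a : all (P a) (l a) = foldr (fun x r => P a x && r) true (l a) by elim: (l a).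
apply: poly_ext E _; apply: (poly_foldr (step := fun a x r => P a x && r) (b := fun _ => 1)) => //.
- exact: poly_cst.
- apply: poly_and; last by poly_base.
  by apply: (poly_comp (f := fun q : A * T * bool => q.1) _ HP); poly_base.
- exact: pbd_cst.
by move=> a i; case: (foldr _ _ _).
Qed.

Lemma poly_cat T {eT : Enc T} (l r : A -> seq T) :
  poly l -> poly r -> poly (fun a => l a ++ r a).
Proof.
move=> Hl Hr; have E a s : s ++ r a = foldr (fun (x : T) r => x :: r) (r a) s.
  by elim: s => //= x s ->.
apply: poly_ext (fun a => E a (l a)) _; apply: (poly_foldr (step := fun _ x r => x :: r)
  (b := fun a => vsize (enc (l a)) + vsize (enc (r a)))) => //.
- by poly_base.
- by apply: pbdD; exact: pbd_poly.
move=> a i; rewrite -E; apply: leq_trans (vsize_cat _ _) _.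
by rewrite leq_add2r vsize_drop.
Qed.

End Folds.

(** * Ranges, concatenation, selection and access in lists *)

Section Lists.
Context {A : Type} {eA : Enc A}.

(** The range is measured by the length of a list: the numbers below a number given in binary would
    form a list of exponential length. *)
Lemma poly_iota T {eT : Enc T} (l : A -> seq T) :
  poly l -> poly (fun a => iota 0 (size (l a))).
Proof.
move=> Hl.
(* Processing the list from its right end, the length of the part already built is the next
   number. *)
have E (s : seq T) : rev (iota 0 (size s)) = foldr (fun _ r => size r :: r) [::] s.
  elim: s => //= x s <-; rewrite size_rev size_iota -rev_rcons -cats1.
  by rewrite -[_ :: _]/(iota 0 (size s).+1) -addn1 iotaD.
apply: poly_ext (poly_rev (l := fun a => rev (iota 0 (size (l a)))) _).
  by move=> a; rewrite revK.
apply: poly_ext (fun a => E (l a)) _.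
pose (b := fun a => (vsize (enc (l a)) * (vsize (enc (l a))).+2).+1).
apply: (poly_foldr (step := fun _ _ r => size r :: r) (b := b)) => //.
- exact: poly_cst.
- by apply: poly_cons; [apply: poly_size|]; poly_base.
- by apply: pbdS; apply: pbdM; do ?apply: pbdS; exact: pbd_poly.
move=> a i; rewrite -E vsize_rev.
have lei : size (drop i (l a)) <= vsize (enc (l a)).
  exact: leq_trans (size_vsize _) (vsize_drop _ _).
apply: leq_trans (vsize_seq_leq (M := (vsize (enc (l a))).+1) _) _.
  move=> x; rewrite mem_iota => /andP[_ lt_x].
  apply: leq_trans (bits_leqS x) _; lia.
by rewrite size_iota ltnS leq_mul2r lei orbT.
Qed.

Lemma poly_flatten T {eT : Enc T} (l : A -> seq (seq T)) :
  poly l -> poly (fun a => flatten (l a)).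
Proof.
move=> Hl; apply: (poly_foldr (step := fun _ x r => x ++ r)
  (b := fun a => vsize (enc (l a)))) => //.
- exact: poly_cst.
- by apply: poly_cat; poly_base.
- exact: pbd_poly.
move=> a i; apply: leq_trans (vsize_drop _ i); elim: (drop _ _) => // x s IH.
by apply: leq_trans (vsize_cat _ _) _; apply: leqW; rewrite leq_add2l.
Qed.

(** The accumulator is always [z a] or an entry of [l a], so it cannot grow. *)
Lemma poly_select T {eT : Enc T} (R : A -> T -> T -> bool) (z : A -> T) (l : A -> seq T) :
  poly l -> poly z -> poly (fun q : A * T * T => R q.1.1 q.1.2 q.2) ->
  poly (fun a => foldl (fun y x => if R a x y then x else y) (z a) (l a)).
Proof.
move=> Hl Hz HR; apply: (poly_foldl (step := fun a x y => if R a x y then x else y)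
  (b := fun a => vsize (enc (z a)) + vsize (enc (l a)))) => //.
- by poly_base.
- by apply: pbdD; exact: pbd_poly.
move=> a i; apply: (@leq_trans (vsize (enc (z a)) + vsize (enc (take i (l a))))).
  elim: (take _ _) (z a) => [|x s IH] y /=; first by rewrite leq_addr.
  apply: leq_trans (IH _) _; rewrite vsize_cons.
  by case: (R a x y); lia.
by rewrite leq_add2l vsize_take.
Qed.

Lemma poly_index (x : A -> nat) (l : A -> seq nat) :
  poly x -> poly l -> poly (fun a => index (x a) (l a)).
Proof.
move=> Hx Hl.
have E y s : index y s = foldr (fun z r => if z == y then 0 else r.+1) 0 s.
  by elim: s => //= z s ->.
apply: (poly_ext (g := fun a => foldr (fun z r => if z == x a then 0 else r.+1) 0 (l a))).
  by move=> a; rewrite E.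
apply: (poly_foldr (step := fun a z r => if z == x a then 0 else r.+1)
  (b := fun a => (vsize (enc (l a))).+1)) => //.
- exact: poly_cst.
- by poly_base; apply: (poly_comp (f := fun q : A * nat * nat => q.1.1) _ Hx); poly_base.
- by apply: pbdS; exact: pbd_poly.
move=> a i; rewrite -E; apply: leq_trans (bits_leqS _) _.
rewrite ltnS (leq_trans (index_size _ _)) //.
exact: leq_trans (size_vsize _) (vsize_drop _ _).
Qed.

Lemma poly_nth T {eT : Enc T} (x0 : T) (l : A -> seq T) (k : A -> nat) :
  poly l -> poly k -> poly (fun a => nth x0 (l a) (k a)).
Proof.
move=> Hl Hk.
(* The accumulator holds the number of entries read and the entry found so far, initially the
   default [x0]. *)
pose (step := fun a x (s : nat * T) => (s.1.+1, if s.1 == k a then x else s.2)).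
have E a s : foldl (fun r x => step a x r) (0, x0) s = (size s, nth x0 s (k a)).
  elim/last_ind: s => [|s x IH]; first by rewrite nth_nil.
  rewrite -cats1 foldl_cat IH /= /step /= size_cat addn1 cats1 nth_rcons.
  rewrite [k a == _]eq_sym; case: ltngtP => // lt_s.
  by rewrite nth_default // ltnW.
apply: (poly_ext (g := fun a => (foldl (fun r x => step a x r) (0, x0) (l a)).2)).
  by move=> a; rewrite E.
apply: poly_snd; apply: (poly_foldl (step := step)
  (b := fun a => (vsize (enc x0) + (vsize (enc (l a)) + vsize (enc (l a))).+1).+1)) => //.
- exact: poly_cst.
- by poly_base; apply: (poly_comp (f := fun q : A * T * (nat * T) => q.1.1) _ Hk); poly_base.
- apply: pbdS; apply: pbdD; first exact: pbd_cst.
  by apply: pbdS; apply: pbdD; exact: pbd_poly.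
move=> a i; rewrite E; set s := take i _.
have le_s : vsize (enc s) <= vsize (enc (l a)) by exact: vsize_take.
have n_s : vsize (enc (nth x0 s (k a))) <= vsize (enc x0) + vsize (enc s).
  elim: (s) (k a) => [|x r IH] j; first by rewrite nth_nil leq_addr.
  rewrite vsize_cons.
  by case: j => [|j] /=; [|have := IH j]; lia.
rewrite vsize_pair -[vsize (enc (size s))]/(bits (size s)).
by have := bits_leqS (size s); have : size s <= vsize (enc s) by [exact: size_vsize]; lia.
Qed.

End Lists.

(** * The algorithm *)

Lemma mem_select (T : eqType) (R : T -> T -> bool) (z : T) (l : seq T) :
  foldl (fun b y => if R y b then y else b) z l \in z :: l.
Proof.
elim: l z => [|y l IH] z /=; first by rewrite mem_head.
have := IH (if R y z then y else z); rewrite !inE.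
by case: (R y z) => /orP[->|->]; rewrite ?orbT.
Qed.

(* (alpha, (C, (V, (Pi, (p, w))))), with the candidates as numbers *)
Definition input : Type :=
  seq nat * (seq nat * (seq (seq nat) * (seq (seq nat) * (nat * seq nat)))).

Definition in_scores (x : input) := x.1.
Definition in_cands (x : input) := x.2.1.
Definition in_votes (x : input) := x.2.2.1.
Definition in_prices (x : input) := x.2.2.2.1.
Definition in_desig (x : input) := x.2.2.2.2.1.
Definition in_weights (x : input) := x.2.2.2.2.2.
Definition in_voters (x : input) := iota 0 (size (in_weights x)).

Section Algorithm.
Variable x : input.
Implicit Types (t y z : seq nat) (i k d : nat) (q : nat * nat).
Let p := in_desig x.

Definition price_of i k := nth 0 (nth [::] (in_prices x) i) k.

(** Closed form of the position of [d] after the shift, which spares the program the construction of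
    the shifted ranking; see [index_shift_up]. *)
Definition place i k d :=
  let v := nth [::] (in_votes x) i in
  if d == p then index p v - k
  else if (index p v - k <= index d v) && ((index d v).+1 <= index p v)
  then (index d v).+1 else index d v.

Definition total_cost t := \sum_(i <- in_voters x) price_of i (nth 0 t i).

Definition total_score t d := \sum_(i <- in_voters x)
  nth 0 (in_weights x) i * nth 0 (in_scores x) (place i (nth 0 t i) d).

Definition wins t := all (fun d => total_score t d <= total_score t p) (in_cands x).

(** Missing entries of [t] count as 0, so [[::]] stands for the action without shifts; the result
    always has one entry per voter. *)
Definition set_shift t i k := [seq if j == i then k else nth 0 t j | j <- in_voters x].

Definition single_shifts : seq (nat * nat) :=
  flatten [seq [seq (i, k) | k <- iota 0 (size (nth [::] (in_prices x) i))]
          | i <- in_voters x].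

(** Comparison of the ratios of extra cost to extra points, relative to [t], multiplied out to avoid
    fractions. A list without gain in points counts as having infinite ratio. *)
Definition better t y z :=
  ((total_score t p).+1 <= total_score y p) &&
  ((total_score z p <= total_score t p) ||
   (((total_cost y - total_cost t) * (total_score z p - total_score t p)).+1 <=
    (total_cost z - total_cost t) * (total_score y p - total_score t p))).

(** A shift that is too expensive is replaced by [t] itself, which gains no points and is therefore
    never preferred. *)
Definition best_move cap t :=
  foldl (fun z y => if better t y z then y else z) t
    [seq if price_of q.1 q.2 <= cap then set_shift t q.1 q.2 else t | q <- single_shifts].

Definition greedy_step cap t := if wins t then t else best_move cap t.

(* The list of all prices only serves as a counter: the sum of the shifts
   increases with every step and remains smaller than the length of that
   list. *)
Definition greedy q :=
  foldl (fun t _ => greedy_step (price_of q.1 q.2) t) (set_shift [::] q.1 q.2)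
    (flatten (in_prices x)).

Definition cheaper y z := wins y && (~~ wins z || ((total_cost y).+1 <= total_cost z)).

Definition solution :=
  foldl (fun z y => if cheaper y z then y else z) [seq 0 | _ <- in_voters x]
    [seq greedy q | q <- single_shifts].

Lemma single_shiftsP i k :
  reflect (i < size (in_weights x) /\ k < size (nth [::] (in_prices x) i))
    ((i, k) \in single_shifts).
Proof.
apply: (iffP flatten_mapP) => [[j jx /mapP[l lx [-> ->]]]|[ix kx]].
  by move: jx lx; rewrite !mem_iota.
exists i; first by rewrite mem_iota.
by apply/mapP; exists k; rewrite // mem_iota.
Qed.

(** Invariants are stated after any number [r] of rounds because the size bound in [poly_foldl]
    concerns all prefixes of a run. *)
Lemma greedy_ind (P : seq nat -> Prop) q r :
  P (set_shift [::] q.1 q.2) ->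
  (forall t i k, (i, k) \in single_shifts -> P t -> P (set_shift t i k)) ->
  P (foldl (fun t _ => greedy_step (price_of q.1 q.2) t) (set_shift [::] q.1 q.2)
       (take r (flatten (in_prices x)))).
Proof.
move=> P0 PS; elim: (take _ _) (set_shift _ _ _) P0 => //= _ l IH t Pt.
apply: IH; rewrite /greedy_step; case: ifP => // _.
have := mem_select (better t) t
  [seq if price_of q'.1 q'.2 <= price_of q.1 q.2 then set_shift t q'.1 q'.2 else t
  | q' <- single_shifts].
rewrite inE => /orP[/eqP E|/mapP[[i k] ik E]]; rewrite /best_move E //=.
by case: ifP => // _; exact: PS.
Qed.

End Algorithm.

(* [apply:] unfolds the definitions that stand in the way of a combinator. *)
Ltac poly_list := repeat first
  [ progress poly_base
  | apply: poly_nth | apply: poly_index | apply: poly_sum | apply: poly_map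
  | apply: poly_iota | apply: poly_flatten | apply: poly_all | apply: poly_select
  | match goal with H : poly ?f |- poly (fun q => ?f (@?g q)) =>
      apply: (poly_comp (f := g) _ H) end ].

(** * Running time of the algorithm *)

Lemma poly_greedy_step A {eA : Enc A} (x : A -> input) (cap : A -> nat) (t : A -> seq nat) :
  poly x -> poly cap -> poly t ->
  poly (fun a => greedy_step (x a) (cap a) (t a)).
Proof.
move=> Hx Hc Ht; rewrite /greedy_step /best_move; poly_list.
Qed.

Lemma vsize_set_shift x t i k M :
  size (in_weights x) <= M -> {in t, forall e, bits e <= M} -> bits k <= M -> 0 < M ->
  size (set_shift x t i k) <= M /\ {in set_shift x t i k, forall e, bits e <= M}.
Proof.
move=> wM tM kM M0; rewrite size_map size_iota; split=> // e /mapP[j _ ->].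
case: ifP => // _; case: (ltnP j (size t)) => jt; last by rewrite nth_default.
exact: tM (mem_nth _ jt).
Qed.

(** Every state has one entry per voter, and each entry is 0, the guessed shift or an index into a
    price list, so states stay small. The guess is arbitrary here, hence its size in [M]. *)
Lemma poly_greedy A {eA : Enc A} (x : A -> input) (q : A -> nat * nat) :
  poly x -> poly q -> poly (fun a => greedy (x a) (q a)).
Proof.
move=> Hx Hq; rewrite /greedy.
pose (M := fun a => (vsize (enc (x a)) + vsize (enc (q a))).+1).
have HM : pbd M by apply: pbdS; apply: pbdD; exact: pbd_poly.
apply: (poly_foldl (b := fun a => (M a * (M a).+1).+1)
  (step := fun a _ t => greedy_step (x a) (price_of (x a) (q a).1 (q a).2) t)).
- by rewrite /in_prices; poly_list.
- by poly_list.
- by apply: poly_greedy_step; poly_list.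
- by apply: pbdS; apply: pbdM => //; apply: pbdS.
move=> a r.
have wM : size (in_weights (x a)) <= M a.
  apply: leq_trans (size_vsize (in_weights (x a))) _.
  apply: (@leq_trans (vsize (enc (x a)))); last exact: leqW (leq_addr _ _).
  by do 4![apply: leq_trans (vsize_snd _) _]; exact: vsize_snd.
have pM i : size (nth [::] (in_prices (x a)) i) <= vsize (enc (x a)).
  case: (ltnP i (size (in_prices (x a)))) => lt_i; last by rewrite nth_default.
  apply: leq_trans (size_vsize _) _; apply: (@leq_trans (vsize (enc (in_prices (x a))))).
    elim: (in_prices (x a)) i lt_i => // l s IH [|i] /= lt_i; rewrite vsize_cons; first lia.
    by have := IH i lt_i; lia.
  apply: leq_trans (vsize_fst _) _.
  by do 2![apply: leq_trans (vsize_snd _) _]; exact: vsize_snd.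
have kM : bits (q a).2 <= M a.
  by apply: leqW; apply: leq_trans (leq_addl _ _); exact: (vsize_snd (q a)).
have [||tM bM] := @greedy_ind (x a)
  (fun t => size t <= M a /\ {in t, forall e, bits e <= M a}) (q a) r.
- exact: vsize_set_shift.
- move=> t i k /single_shiftsP[_ lt_k] [_ Ht]; apply: vsize_set_shift => //.
  by apply: leq_trans (bits_leqS k) _; rewrite ltnS (leq_trans (ltnW lt_k)) //
    (leq_trans (pM i)) // leq_addr.
apply: leq_trans (vsize_seq_leq bM) _.
by rewrite ltnS leq_mul2r tM orbT.
Qed.

Lemma poly_solution A {eA : Enc A} (x : A -> input) : poly x -> poly (fun a => solution (x a)).
Proof.
move=> Hx; rewrite /solution /in_voters /in_weights; poly_list.
by apply: poly_greedy; poly_list.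
Qed.

(** * The exchange argument *)

(** Only the candidates that [p] overtakes move, each down by one place: those from the new place of
    [p] to just above its old one. *)
Lemma index_shift_up (T : eqType) (p d : T) (k : nat) (s : seq T) :
  uniq s -> p \in s -> d \in s ->
  index d (shift_up p k s) =
  if d == p then index p s - k
  else if index p s - k <= index d s < index p s then (index d s).+1 else index d s.
Proof.
move=> Us ps; rewrite /shift_up; case/splitPr: ps Us => s1 s2.
rewrite cat_uniq /= negb_or => /and4P[U1 /andP[p1 s12] p2 U2] ds.
have E1 : index p (s1 ++ p :: s2) = size s1 by rewrite index_cat (negbTE p1) /= eqxx addn0.
have Er : rem p (s1 ++ p :: s2) = s1 ++ s2.
  by elim: (s1) p1 => [|y r IH] /=; rewrite ?eqxx // inE negb_or eq_sym => /andP[/negbTE-> /IH->].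
rewrite E1 Er; set j := size s1 - k; have js : j <= size s1 by exact: leq_subr.
have Et : take j (s1 ++ s2) = take j s1 by rewrite takel_cat.
have Ed : drop j (s1 ++ s2) = drop j s1 ++ s2.
  rewrite drop_cat; case: ltngtP js => // -> _; by rewrite subnn drop0 drop_size.
have st : size (take j s1) = j by rewrite size_takel.
rewrite Et Ed; have [->|dp] := eqVneq d p.
  rewrite index_cat st ifN /=; first by rewrite eqxx addn0.
  by apply: contra p1; exact: mem_take.
rewrite !index_cat /= st [p == d]eq_sym (negbTE dp) index_cat.
have E : (d \in s1) = (d \in take j s1) || (d \in drop j s1).
  by rewrite -mem_cat cat_take_drop.
have sd : size (drop j s1) = size s1 - j by rewrite size_drop.
rewrite E; case: (boolP (d \in take j s1)) => [dt|dNt] /=.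
  have lt_d : index d (take j s1) < j by rewrite -{2}st index_mem.
  have -> : index d s1 = index d (take j s1).
    by rewrite -{1}(cat_take_drop j s1) index_cat dt.
  by rewrite leqNgt lt_d.
case: (boolP (d \in drop j s1)) => [dd|dNd] /=.
  have lt_d : index d (drop j s1) < size s1 - j by rewrite -sd index_mem.
  have -> : index d s1 = j + index d (drop j s1).
    by rewrite -{1}(cat_take_drop j s1) index_cat (negbTE dNt) st.
  by rewrite leq_addr /= ifT ?addnS // -ltn_subRL.
rewrite sd; case: ifP => [|_]; first by lia.
lia.
Qed.

Lemma sumn_iota_ord n (F : nat -> nat) : \sum_(i <- iota 0 n) F i = \sum_(i < n) F i.
Proof. by rewrite -(big_mkord xpredT F) /index_iota subn0. Qed.

Section Exchange.
Variables (n : nat) (cost pts : 'I_n -> nat -> nat).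

(* [sc i k] is what voter [i] gives to some rival of the designated candidate
   when the latter is shifted by [k]. *)
Variable sc : 'I_n -> nat -> nat.
Hypothesis sc_anti : forall i k l, k <= l -> sc i l <= sc i k.
Hypothesis sc_slow : forall i k l, k <= l -> sc i k + pts i k <= sc i l + pts i l.

Variables u t : 'I_n -> nat.
Hypothesis u_loses : \sum_i pts i (u i) < \sum_i sc i (u i).
Hypothesis t_wins : \sum_i sc i (t i) <= \sum_i pts i (t i).

Let x i := maxn (u i) (t i).

(** Writing [x] for the join, [pts x - pts u >= sc u - sc x > pts u - sc t >= pts u - pts t]: the
    rival beats [p] in [u], has at most as many points in [x] as in [t], and does not beat [p] in
    [t]. *)
Lemma exchange_points : 2 * \sum_i pts i (u i) < \sum_i pts i (x i) + \sum_i pts i (t i).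
Proof.
have le_ux : \sum_i sc i (u i) + \sum_i pts i (u i) <= \sum_i sc i (x i) + \sum_i pts i (x i).
  by rewrite -!big_split; apply: leq_sum => i _; apply: sc_slow; exact: leq_maxl.
have le_xt : \sum_i sc i (x i) <= \sum_i sc i (t i).
  by apply: leq_sum => i _; apply: sc_anti; exact: leq_maxr.
lia.
Qed.

(** Otherwise neither [t] nor the join would have more points than [u], against [exchange_points].
    So a move with positive gain exists as long as [p] is beaten. *)
Lemma exchange_progress : exists i, pts i (u i) < pts i (t i).
Proof.
apply/existsP; rewrite -[[exists _, _]]negbK negb_exists; apply/negP => /forallP H.
have le_tu : \sum_i pts i (t i) <= \sum_i pts i (u i).
  by apply: leq_sum => i _; rewrite leqNgt.
have le_xu : \sum_i pts i (x i) <= \sum_i pts i (u i).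
  apply: leq_sum => i _; rewrite /x; case: (leqP (u i) (t i)) => // _.
  by rewrite leqNgt.
by have := exchange_points; lia.
Qed.

(** The slope is [a / b]. Minimality against [t] voter by voter also gives minimality against the
    join, whose entries are those of [u] or [t]. *)
Lemma exchange_cost a b : 0 < b ->
  (forall i, b * cost i (u i) + a * pts i (t i) <= b * cost i (t i) + a * pts i (u i)) ->
  \sum_i cost i (u i) + \sum_i cost i (minn (u i) (t i)) <= 2 * \sum_i cost i (t i).
Proof.
move=> b0 opt_u.
have Ht : b * \sum_i cost i (u i) + a * \sum_i pts i (t i) <=
          b * \sum_i cost i (t i) + a * \sum_i pts i (u i).
  by rewrite !big_distrr -!big_split; apply: leq_sum => i _; exact: opt_u.
have Hx : b * \sum_i cost i (u i) + a * \sum_i pts i (x i) <=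
          b * \sum_i cost i (x i) + a * \sum_i pts i (u i).
  rewrite !big_distrr -!big_split; apply: leq_sum => i _ /=.
  by rewrite /x; case: (leqP (u i) (t i)) => _ //; exact: opt_u.
(* Modularity: voter by voter, the join and the meet are [u] and [t] in some order. *)
have Hm : \sum_i cost i (x i) + \sum_i cost i (minn (u i) (t i)) =
          \sum_i cost i (u i) + \sum_i cost i (t i).
  rewrite -!big_split; apply: eq_bigr => i _ /=.
  by rewrite /x; case: (leqP (u i) (t i)) => _ //; rewrite addnC.
have Hp := exchange_points.
suff: 2 * \sum_i cost i (u i) <= \sum_i cost i (t i) + \sum_i cost i (x i) by lia.
rewrite -(leq_pmul2l b0); nia.
Qed.

End Exchange.

(** Cross-multiplied comparison of the ratios [C / G] is transitive through a positive [G z]. The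
    lemma serves twice: for the greedy move, where [G] is the gain in points, and for the final
    choice, where [G] is 1 for success and 0 for failure. *)
Lemma foldl_min_ratio (T : eqType) (C G : T -> nat) (R : T -> T -> bool) (z0 : T) (l : seq T) :
  (forall y z, R y z = (0 < G y) && ((G z == 0) || (C y * G z < C z * G y))) ->
  let z := foldl (fun z y => if R y z then y else z) z0 l in
  {in l, forall y, 0 < G y -> 0 < G z /\ C z * G y <= C y * G z}.
Proof.
move=> HR; elim/last_ind: l => [|l y IH] // .
rewrite -cats1 foldl_cat /=; set z := foldl _ _ l in IH *.
move=> w; rewrite mem_cat mem_seq1 => /orP[wl|/eqP->] Gw.
  have [Gz le_zw] := IH w wl Gw; rewrite HR; case: ifP => // /andP[Gy].
  rewrite eqn0Ngt Gz /= => lt_yz; split=> //.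
  by rewrite -(leq_pmul2l Gz); nia.
rewrite HR Gw /=; case: ifP => [_|/negbT]; first by split.
by rewrite negb_or -lt0n -leqNgt => /andP[].
Qed.

(** * Greedy moves along the lower convex hull *)

Section Greedy.
Variables (n : nat) (cost pts : 'I_n -> nat -> nat) (base pos : 'I_n -> nat) (cap : nat).
Hypothesis cost_mono : forall i, {homo cost i : k l / k <= l}.
Hypothesis pts_mono : forall i, {homo pts i : k l / k <= l}.

Definition feasible i k := [&& base i <= k, k <= pos i & cost i k <= cap].

(* The minimisers of [b * cost - a * pts] among the feasible shifts are the
   vertices and edges of the lower convex hull of the points [(pts, cost)]. *)
Definition on_hull (u : 'I_n -> nat) :=
  (forall i, feasible i (u i)) /\
  exists a b, 0 < b /\ forall i k, feasible i k ->
    b * cost i (u i) + a * pts i k <= b * cost i k + a * pts i (u i).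

Definition update (u : 'I_n -> nat) (i : 'I_n) k j := if j == i then k else u j.

(** Stated with sums on both sides to avoid truncated subtraction. *)
Lemma sum_update (F : 'I_n -> nat -> nat) u i k :
  \sum_j F j (update u i k j) + F i (u i) = \sum_j F j (u j) + F i k.
Proof.
rewrite (bigD1 i) //= [in RHS](bigD1 i) //= /update eqxx.
rewrite (eq_bigr (fun j => F j (u j))) => [|j /negbTE-> //]; lia.
Qed.

Lemma on_hull_base : (forall i, feasible i (base i)) -> on_hull base.
Proof.
(* At slope 0 only the cost counts, and [base] is the least feasible shift. *)
move=> fb; split=> //; exists 0, 1; split=> // i k /and3P[le_k _ _].
by rewrite !mul1n !mul0n !addn0 cost_mono.
Qed.

(** The new slope is the ratio [A / B] of the chosen move. At this slope [u] is still minimal, and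
    the move leaves [B * cost - A * pts] unchanged. *)
Lemma on_hull_update u i k :
  on_hull u -> k <= pos i -> cost i k <= cap -> pts i (u i) < pts i k ->
  (forall j l, l <= pos j -> cost j l <= cap -> pts j (u j) < pts j l ->
    (cost i k - cost i (u i)) * (pts j l - pts j (u j)) <=
    (cost j l - cost j (u j)) * (pts i k - pts i (u i))) ->
  on_hull (update u i k).
Proof.
move=> [fu [a0 [b0 [b0_gt0 min_u]]]] kpos kcap lt_pts best.
have up j l : pts j (u j) < pts j l -> u j <= l.
  by move=> lt_j; rewrite leqNgt; apply/negP => /ltnW /(@pts_mono j); rewrite leqNgt lt_j.
have fk : feasible i k.
  rewrite /feasible kpos kcap !andbT; have /and3P[le_b _ _] := fu i.
  exact: leq_trans le_b (up _ _ lt_pts).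
have := best; have := cost_mono i (up _ _ lt_pts); move: (lt_pts).
set A := cost i k - _; set B := pts i k - _ => {}lt_pts le_cost {}best.
have EA : cost i k = cost i (u i) + A by rewrite /A; lia.
have EB : pts i k = pts i (u i) + B by rewrite /B; lia.
have B_gt0 : 0 < B by rewrite /B; lia.
(* The slope does not decrease, because [u] was minimal against [k] at the old slope. *)
have slope : a0 * B <= b0 * A.
  by have := min_u i k fk; rewrite EA EB; nia.
(* Shifts that gain points are covered by the choice of the move; against the others, a steeper
   slope only favours [u]. *)
have min_u' j l : feasible j l ->
    B * cost j (u j) + A * pts j l <= B * cost j l + A * pts j (u j).
  move=> fl; have /and3P[_ lpos lcap] := fl.
  case: (ltnP (pts j (u j)) (pts j l)) => lt_l.
    have le_l := cost_mono j (up _ _ lt_l); have := best j l lpos lcap lt_l.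
    set P := pts j l - _; set Q := cost j l - _ => PQ.
    have -> : pts j l = pts j (u j) + P by rewrite /P; lia.
    have -> : cost j l = cost j (u j) + Q by rewrite /Q; lia.
    nia.
  have := min_u j l fl; set P := pts j (u j) - pts j l.
  have -> : pts j (u j) = pts j l + P by rewrite /P; lia.
  by move=> le_l; rewrite -(leq_pmul2l b0_gt0); nia.
split=> [j|]; first by rewrite /update; case: eqP => [->|_].
exists A, B; split=> // j l fl; rewrite /update; case: eqP => [E|_]; last exact: min_u'.
by rewrite {j}E in fl *; have := min_u' i l fl; rewrite EA EB; nia.
Qed.

End Greedy.

(** * Correctness on instances *)

Lemma nth_map_enum n T (x0 : T) (f : 'I_n -> T) (i : 'I_n) :
  nth x0 [seq f j | j <- enum 'I_n] i = f i.
Proof. by rewrite (nth_map i) ?size_enum_ord // nth_ord_enum. Qed.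

Lemma map_iota_enum n T (f : nat -> T) : [seq f i | i <- iota 0 n] = [seq f i | i : 'I_n].
Proof. by rewrite -val_enum_ord -map_comp. Qed.

Section Instance.
Variables (m n : nat) (alpha : scoring_vector m) (I : instance m n).

Definition to_input : input :=
  (alpha : seq nat, ([seq nat_of_ord c | c <- enum 'I_m],
  ([seq [seq nat_of_ord c | c <- voter I i] | i <- enum 'I_n],
  ([seq [seq price I i k | k <- iota 0 (index (designated I) (voter I i)).+1] | i <- enum 'I_n],
  (nat_of_ord (designated I), [seq weight I i | i <- enum 'I_n]))))).

Lemma enc_seq_map T U (e : U -> val) (f : T -> U) s :
  enc_seq e [seq f y | y <- s] = enc_seq (fun y => e (f y)) s.
Proof. by elim: s => //= y s ->. Qed.

Lemma eq_enc_seq T (e e' : T -> val) s : e =1 e' -> enc_seq e s = enc_seq e' s.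
Proof. by move=> ee; elim: s => //= y s ->; rewrite ee. Qed.

Lemma enc_to_input : enc to_input = Pair (enc_scoring alpha) (enc_instance I).
Proof.
rewrite /to_input /enc_instance /enc /enc_prod /enc /enc_list /= !enc_seq_map.
congr (Pair _ (Pair _ (Pair _ (Pair _ _)))); rewrite ?enc_seq_map //.
  by apply: eq_enc_seq => i; rewrite /enc_vote /enc enc_seq_map.
apply: eq_enc_seq => i; rewrite -[price I i 0 :: _]/(map (price I i) (iota 0 _.+1)).
by rewrite /enc_price /enc enc_seq_map.
Qed.

Local Notation x := to_input.
Local Notation p := (designated I).
Let pos i := index p (voter I i).
Let cost i k := price I i k.
Let sc (d : 'I_m) i k := weight I i * nth 0 alpha (index d (shift_up p k (voter I i))).
Let pts i k := weight I i * nth 0 alpha (pos i - k).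

Definition of_fun (u : 'I_n -> nat) : seq nat := [seq u i | i <- enum 'I_n].

Lemma in_voters_to_input : in_voters x = iota 0 n.
Proof. by rewrite /in_voters size_map size_enum_ord. Qed.

Lemma sum_voters (F : nat -> nat) : \sum_(i <- in_voters x) F i = \sum_(i < n) F i.
Proof. by rewrite in_voters_to_input sumn_iota_ord. Qed.

Lemma size_prices i : size (nth [::] (in_prices x) (i : 'I_n)) = (pos i).+1.
Proof. by rewrite nth_map_enum size_map size_iota. Qed.

Lemma price_of_to_input (i : 'I_n) k : k <= pos i -> price_of x i k = price I i k.
Proof.
move=> le_k; rewrite /price_of nth_map_enum (nth_map 0) ?size_iota //.
by rewrite nth_iota.
Qed.

Lemma place_to_input (i : 'I_n) k (d : 'I_m) :
  place x i k d = index d (shift_up p k (voter I i)).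
Proof.
rewrite /place /in_votes /in_desig nth_map_enum /= !(index_map (@ord_inj m)).
by rewrite index_shift_up ?ranking_uniq ?mem_vote.
Qed.

Lemma scp i k : sc p i k = pts i k.
Proof. by rewrite /sc index_shift_up ?ranking_uniq ?mem_vote // eqxx. Qed.

Lemma total_score_to_input u (d : 'I_m) : total_score x (of_fun u) d = \sum_i sc d i (u i).
Proof.
rewrite /total_score sum_voters; apply: eq_bigr => i _.
by rewrite !nth_map_enum place_to_input.
Qed.

Lemma total_score_p u : total_score x (of_fun u) p = \sum_i pts i (u i).
Proof. by rewrite total_score_to_input; apply: eq_bigr => i _; exact: scp. Qed.

Lemma total_cost_to_input u : (forall i, u i <= pos i) ->
  total_cost x (of_fun u) = \sum_i cost i (u i).
Proof.
move=> le_u; rewrite /total_cost sum_voters; apply: eq_bigr => i _.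
by rewrite nth_map_enum price_of_to_input.
Qed.

Lemma winsP u : reflect (forall d, \sum_i sc d i (u i) <= \sum_i pts i (u i)) (wins x (of_fun u)).
Proof.
apply: (iffP allP) => [H d|H _ /mapP[d _ ->]].
  rewrite -total_score_to_input -total_score_p; apply: H.
  by apply: map_f; rewrite mem_enum.
by rewrite total_score_to_input [X in _ <= X]total_score_p.
Qed.

Lemma set_shift_to_input u (i : 'I_n) k : set_shift x (of_fun u) i k = of_fun (update u i k).
Proof.
rewrite /set_shift in_voters_to_input map_iota_enum; apply: eq_map => j.
by rewrite /update -val_eqE nth_map_enum.
Qed.

Lemma set_shift_nil (i : 'I_n) k :
  set_shift x [::] i k = of_fun (update (fun _ => 0) i k).
Proof.
rewrite /set_shift in_voters_to_input map_iota_enum; apply: eq_map => j.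
by rewrite /update -val_eqE nth_nil.
Qed.

Lemma single_shifts_to_input i k :
  (i, k) \in single_shifts x -> exists2 i' : 'I_n, i = i' & k <= pos i'.
Proof.
move=> /single_shiftsP[]; rewrite size_map size_enum_ord => lt_i.
by rewrite (size_prices (Ordinal lt_i)); exists (Ordinal lt_i).
Qed.

Lemma mem_single_shifts (i : 'I_n) k : k <= pos i -> (nat_of_ord i, k) \in single_shifts x.
Proof.
move=> le_k; apply/single_shiftsP; split; last by rewrite size_prices.
by rewrite size_map size_enum_ord.
Qed.

Lemma score_anti k l : k <= l -> nth 0 alpha l <= nth 0 alpha k.
Proof.
move=> le_kl; case: (ltnP l (size alpha)) => lt_l; last by rewrite [leqLHS]nth_default.
have geq_trans : transitive geq by move=> a b c /= ab cb; exact: leq_trans cb ab.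
apply: (sorted_leq_nth geq_trans leqnn 0 (scores_sorted alpha)) => //.
exact: leq_ltn_trans le_kl lt_l.
Qed.

Lemma pts_mono i : {homo pts i : k l / k <= l}.
Proof. by move=> k l le_kl; rewrite leq_mul2l score_anti ?orbT // leq_sub2l. Qed.

Lemma cost_mono i : {homo cost i : k l / k <= l}.
Proof.
exact: (@homo_leq _ (cost i) leq leqnn leq_trans (price_leS I i)).
Qed.

Lemma sc_anti d i k l : d != p -> k <= l -> sc d i l <= sc d i k.
Proof.
move=> dp le_kl; rewrite leq_mul2l score_anti ?orbT //.
rewrite !index_shift_up ?ranking_uniq ?mem_vote // (negbTE dp).
by case: ifP => [|/negbT] H1; case: ifP => [|/negbT] H2; lia.
Qed.

(** If [p] overtakes [d] between the shifts [k] and [l], then [d] falls from [j] to [j.+1], while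
    [p] rises from a place no better than [j.+1] to one no worse than [j]. Otherwise [d] keeps its
    points. *)
Lemma sc_slow d i k l : d != p -> k <= l -> sc d i k + pts i k <= sc d i l + pts i l.
Proof.
move=> dp le_kl; rewrite -!mulnDr leq_mul2l; apply/orP; right.
rewrite !index_shift_up ?ranking_uniq ?mem_vote // (negbTE dp) -/(pos i).
have le_pts : nth 0 alpha (pos i - k) <= nth 0 alpha (pos i - l).
  by rewrite score_anti // leq_sub2l.
set j := index d _.
case: ifP => [H1|/negbT H1]; case: ifP => [H2|/negbT H2]; rewrite ?leq_add2l //; first lia.
have le1 : nth 0 alpha (pos i - k) <= nth 0 alpha j.+1 by apply: score_anti; lia.
have le2 : nth 0 alpha j <= nth 0 alpha (pos i - l) by apply: score_anti; lia.
by rewrite addnC leq_add.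
Qed.

(** * The greedy run started from the costliest shift of a successful action *)

Section Guess.
Variables (s : 'I_n -> nat) (i0 : 'I_n).
Hypothesis s_pos : forall i, s i <= pos i.
Hypothesis s_wins : forall d, \sum_i sc d i (s i) <= \sum_i pts i (s i).
Hypothesis s_max : forall i, cost i (s i) <= cost i0 (s i0).
Let cap := cost i0 (s i0).
(** Both the start of the run and the lower bound in [feasible], so every state on the hull retains
    the guessed shift. *)
Let base := update (fun _ => 0) i0 (s i0).
Let hull := on_hull cost pts base pos cap.

Lemma base_s i : base i <= s i.
Proof. by rewrite /base /update; case: eqP => [->|]. Qed.

Lemma feasible_base i : feasible cost base pos cap i (base i).
Proof.
rewrite /feasible leqnn (leq_trans (base_s i)) //=.
exact: leq_trans (cost_mono i (base_s i)) (s_max i).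
Qed.

Lemma hull_pos u i : hull u -> u i <= pos i.
Proof. by move=> [/(_ i)/and3P[]]. Qed.

Lemma greedy_step_to_input u :
  hull u -> ~~ wins x (of_fun u) ->
  exists u', [/\ greedy_step x cap (of_fun u) = of_fun u', hull u',
    \sum_i cost i (u' i) <= 2 * \sum_i cost i (s i) & \sum_i u i < \sum_i u' i].
Proof.
move=> hu loses; have [fu [a [b [b0 min_u]]]] := hu.
have /existsP[d u_loses] : [exists d, \sum_i pts i (u i) < \sum_i sc d i (u i)].
  rewrite -[[exists _, _]]negbK negb_exists; apply: contra loses => /forallP H.
  by apply/winsP => d; rewrite leqNgt.
have dp : d != p.
  apply: contraTneq u_loses => ->; rewrite -leqNgt.
  by apply: leq_sum => i _; rewrite scp.
have fs i : feasible cost base pos cap i (s i) by rewrite /feasible base_s s_pos s_max.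
have [i1 prog_i1] := exchange_progress (fun i k l => sc_anti i dp)
  (fun i k l => sc_slow i dp) u_loses (s_wins d).
(* At [i0] the meet of [u] and [s] equals [s i0], since [u] lies above [base]; so the meet costs at
   least [cap]. *)
have cost_u : \sum_i cost i (u i) + cap <= 2 * \sum_i cost i (s i).
  apply: leq_trans (exchange_cost (fun i k l => sc_anti i dp)
    (fun i k l => sc_slow i dp) u_loses (s_wins d) b0 (fun i => min_u i _ (fs i))).
  rewrite leq_add2l (bigD1 i0) //= (leq_trans _ (leq_addr _ _)) // cost_mono //.
  have /and3P[le_b _ _] := fu i0; rewrite leq_min (leq_trans _ le_b) ?leqnn //.
  by rewrite /base /update eqxx.
pose t := of_fun u.
pose C y := total_cost x y - total_cost x t.
pose G y := total_score x y p - total_score x t p.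
pose l := [seq if price_of x q.1 q.2 <= cap then set_shift x t q.1 q.2 else t
          | q <- single_shifts x].
have HR y z : better x t y z = (0 < G y) && ((G z == 0) || (C y * G z < C z * G y)).
  by rewrite /better /G subn_gt0 subn_eq0.
have := @foldl_min_ratio _ C G (better x t) t l HR; rewrite -/(best_move x cap t) /=.
set z := best_move x cap t => best.
have Gt : G t = 0 by rewrite /G subnn.
have CE i k : k <= pos i -> C (of_fun (update u i k)) = cost i k - cost i (u i).
  move=> le_k; rewrite /C !total_cost_to_input => [|j|j]; last 2 first.
  - exact: hull_pos.
  - by rewrite /update; case: eqP => [->|_] //; exact: hull_pos.
  by have := sum_update cost u i k; lia.
have GE i k : G (of_fun (update u i k)) = pts i k - pts i (u i).
  by rewrite /G !total_score_p; have := sum_update pts u i k; lia.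
have in_l (j : 'I_n) k : k <= pos j -> cost j k <= cap -> of_fun (update u j k) \in l.
  move=> le_k le_cap; apply/mapP; exists (nat_of_ord j, k); first exact: mem_single_shifts.
  by rewrite /= price_of_to_input // le_cap set_shift_to_input.
(* The move of voter [i1] to [s i1] competes and gains points, so the selected list gains points
   too. *)
have [Gz _] : 0 < G z /\
    C z * G (of_fun (update u i1 (s i1))) <= C (of_fun (update u i1 (s i1))) * G z.
  by apply: best; [apply: in_l | rewrite GE subn_gt0].
(* Having positive gain, [z] is not [t], so it stems from a real shift within the cap. *)
have [i [k [Ez le_k le_cap]]] : exists i k,
    [/\ z = of_fun (update u i k), k <= pos i & cost i k <= cap].
  have := mem_select (better x t) t l; rewrite -/(best_move x cap t) -/z inE.
  case/orP=> [/eqP E|/mapP[[j k] /single_shifts_to_input[i -> le_k]]]; first by rewrite E Gt in Gz.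
  rewrite /= price_of_to_input //; case: ifP => [le_cap|_] E; last by rewrite E Gt in Gz.
  by exists i, k; rewrite -set_shift_to_input.
have lt_k : pts i (u i) < pts i k by rewrite Ez GE subn_gt0 in Gz.
have lt_uk : u i < k by rewrite ltnNge; apply/negP => /(@pts_mono i); rewrite leqNgt lt_k.
exists (update u i k); split.
- by rewrite /greedy_step (negbTE loses) -/t -/z.
- apply: on_hull_update => //; [exact: cost_mono | exact: pts_mono | move=> j l' le_l cap_l lt_l].
  by rewrite -!CE // -!GE -Ez; apply: (best _ _ _).2; [exact: in_l | rewrite GE subn_gt0].
- apply: leq_trans cost_u; rewrite -(leq_add2r (cost i (u i))) sum_update -addnA leq_add2l.
  exact: leq_trans le_cap (leq_addr _ _).
by have := sum_update (fun _ => id) u i k; rewrite /=; lia.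
Qed.

(** A winning state is never left. Otherwise the shifts would add up to at least the number of
    rounds, which is the sum of all [pos i] plus [n]; as [i0] shows that [n] is positive, this is
    too much. *)
Lemma greedy_to_input :
  wins x (greedy x (nat_of_ord i0, s i0)) /\
  total_cost x (greedy x (nat_of_ord i0, s i0)) <= 2 * \sum_i cost i (s i).
Proof.
have loop (l : seq nat) u : hull u -> \sum_i cost i (u i) <= 2 * \sum_i cost i (s i) ->
    exists u', [/\ foldl (fun t _ => greedy_step x cap t) (of_fun u) l = of_fun u', hull u',
      \sum_i cost i (u' i) <= 2 * \sum_i cost i (s i) &
      wins x (of_fun u') \/ \sum_i u i + size l <= \sum_i u' i].
  elim: l u => [|y l IH] u hu cu; first by exists u; split=> //; right; rewrite addn0.
  have [wu|lu] := boolP (wins x (of_fun u)).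
    have Eu r : foldl (fun t (_ : nat) => greedy_step x cap t) (of_fun u) r = of_fun u.
      by elim: r => //= _ r; rewrite /greedy_step wu.
    by exists u; split=> //; left.
  have [v [Ev hv cv lt_uv]] := greedy_step_to_input hu lu.
  have [w [Ew hw cw Hw]] := IH v hv cv; exists w; split=> //=; first by rewrite Ev.
  case: Hw => [|le_w]; [by left | right].
  by apply: leq_trans le_w; rewrite /= addnS -addSn leq_add2r.
have base_cost : \sum_i cost i (base i) <= 2 * \sum_i cost i (s i).
  apply: (@leq_trans (\sum_i cost i (s i))); last by rewrite leq_pmull.
  by apply: leq_sum => i _; apply: cost_mono; exact: base_s.
have hull_base : hull base by apply: on_hull_base; [exact: cost_mono | exact: feasible_base].
have [u [Eu hu cu Hu]] := loop (flatten (in_prices x)) base hull_base base_cost.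
rewrite /greedy /= price_of_to_input // set_shift_nil Eu.
rewrite total_cost_to_input => [|i]; last exact: hull_pos.
split=> //; case: Hu => // /(leq_trans (leq_addl _ _)).
have -> : size (flatten (in_prices x)) = \sum_i (pos i).+1.
  rewrite size_flatten /shape -map_comp sumnE big_map big_enum; apply: eq_bigr => i _.
  by rewrite /= size_map size_iota.
have : \sum_i u i <= \sum_i pos i by apply: leq_sum => i _; exact: hull_pos.
move=> le_u le_p; have : \sum_i (pos i).+1 <= \sum_i pos i by exact: leq_trans le_u.
rewrite (eq_bigr (fun i => pos i + 1)) => [|i _]; last by rewrite addn1.
rewrite big_split /= sum1_card card_ord -{2}[\sum_i pos i]addn0 leq_add2l leqNgt.
by rewrite (leq_ltn_trans _ (ltn_ord i0)).
Qed.

End Guess.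

(** * The cheapest successful outcome over all guesses *)

(** Wrong guesses, too, keep every shift within the range of its price list, so [total_cost] is the
    true cost of whatever is returned. *)
Lemma greedy_of_fun q : q \in single_shifts x ->
  exists2 u, greedy x q = of_fun u & forall i, u i <= pos i.
Proof.
case: q => i k /single_shifts_to_input[{}i -> le_k].
have upd u (j : 'I_n) l : (forall h, u h <= pos h) -> l <= pos j ->
    forall h, update u j l h <= pos h.
  by move=> le_u le_l h; rewrite /update; case: eqP => [->|].
rewrite /greedy -[flatten _]take_size; apply: (greedy_ind
  (P := fun t => exists2 u, t = of_fun u & forall i, u i <= pos i)).
  by rewrite set_shift_nil; eexists; [by [] | exact: upd].
move=> _ _ l /[swap] -[u -> le_u] /single_shifts_to_input[j -> le_l].
by rewrite set_shift_to_input; eexists; [by [] | exact: upd].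
Qed.

Lemma solution_of_fun : exists2 u, solution x = of_fun u & forall i, u i <= pos i.
Proof.
have := mem_select (cheaper x) [seq 0 | _ <- in_voters x] [seq greedy x q | q <- single_shifts x].
rewrite -/(solution x) inE => /orP[/eqP->|/mapP[q /greedy_of_fun Hq ->] //].
by exists (fun _ => 0) => //; rewrite in_voters_to_input map_iota_enum.
Qed.

Lemma solution_best q : q \in single_shifts x -> wins x (greedy x q) ->
  wins x (solution x) /\ total_cost x (solution x) <= total_cost x (greedy x q).
Proof.
(* With gain 1 for a winning list and 0 for any other, the ratio of a winning list is its cost. *)
have HR y z : cheaper x y z = (0 < (wins x y : nat)) && (((wins x z : nat) == 0) ||
    (total_cost x y * wins x z < total_cost x z * wins x y)).
  by rewrite /cheaper; case: (wins x y) => //; case: (wins x z); rewrite //= !muln1.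
move=> xq wq; have := @foldl_min_ratio _ (total_cost x) (fun y => wins x y) (cheaper x)
  [seq 0 | _ <- in_voters x] [seq greedy x q | q <- single_shifts x] HR _ (map_f _ xq).
by rewrite -/(solution x) wq muln1; case: (wins x _) => // -[] // _; rewrite muln1.
Qed.

(** With [price_minn], this allows an optimal action to be cut down to shifts covered by the price
    lists. *)
Lemma sc_minn d i k : sc d i (minn k (pos i)) = sc d i k.
Proof.
rewrite /sc /shift_up.
suff -> : index p (voter I i) - minn k (pos i) = index p (voter I i) - k by [].
rewrite /pos; lia.
Qed.

Lemma price_minn i k : cost i (minn k (pos i)) = cost i k.
Proof.
rewrite /cost; case: (leqP k (pos i)) => // lt_k.
by rewrite (price_top lt_k).
Qed.

Lemma successfulP (t : shift_action n) :
  successful alpha I t <-> forall d, \sum_i sc d i (tnth t i) <= \sum_i pts i (tnth t i).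
Proof.
have E : score alpha (shifted I t) p = \sum_i pts i (tnth t i).
  by apply: eq_bigr => i _; rewrite -scp.
by split=> H d; have := H d; rewrite E.
Qed.

Lemma solution_approx : exists t : shift_action n,
  [/\ enc_action t = enc (solution x), successful alpha I t & Defs.cost I t <= 2 * opt alpha I].
Proof.
have [u Eu le_u] := solution_of_fun; exists [tuple u i | i < n].
have Et : enc_action [tuple u i | i < n] = enc (solution x).
  by rewrite Eu.
rewrite /opt; case: ex_minnP => _ /asboolP[t /successfulP Ht <-] _.
pose s i := minn (tnth t i) (pos i).
have s_pos i : s i <= pos i by exact: geq_minr.
have s_wins d : \sum_i sc d i (s i) <= \sum_i pts i (s i).
  have := Ht d; rewrite (eq_bigr _ (fun i _ => esym (sc_minn d i _))).
  by rewrite [leqRHS](eq_bigr (fun i => pts i (s i))) // => i _; rewrite -!scp sc_minn.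
have s_cost : Defs.cost I t = \sum_i cost i (s i).
  by apply: eq_bigr => i _; rewrite price_minn.
have [Hw Hc] : wins x (of_fun u) /\ \sum_i cost i (u i) <= 2 * \sum_i cost i (s i).
  (* Without voters there is no guess to make, but all sums are empty. *)
  have [n0|n_gt0] := posnP n.
    have no_voter : 'I_n -> False by case=> i; rewrite n0.
    by split; [apply/winsP => d|]; rewrite big1 // => i; case: (no_voter i).
  case: (@arg_maxnP _ (Ordinal n_gt0) xpredT (fun i => cost i (s i)) isT) => i0 _ s_max.
  have [gw gc] := greedy_to_input s_pos s_wins (fun i => s_max i isT).
  have [] := solution_best (mem_single_shifts (s_pos i0)) gw.
  by rewrite Eu => -> /leq_trans/(_ gc); rewrite total_cost_to_input.
split=> //.
  apply/successfulP => d.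
  have /winsP/(_ d) := Hw; congr (_ <= _); apply: eq_bigr => i _; by rewrite tnth_mktuple.
rewrite s_cost; apply: leq_trans Hc; apply: leq_sum => i _.
by rewrite tnth_mktuple.
Qed.

End Instance.

Theorem corollary3p6 :
  exists (B : prog) (c d : nat),
    forall (m n : nat) (alpha : scoring_vector m) (I : instance m n),
      exists (t : shift_action n) (time : nat),
        [/\ runs B (Pair (enc_scoring alpha) (enc_instance I)) time
              (enc_action t),
            successful alpha I t,
            cost I t <= 2 * opt alpha I
          & time <= c * (instance_size I + scoring_size alpha) ^ d].
Proof.
have [[B [s [[c [d Hs]] HB]]]] := poly_solution (@poly_id input _).
(* The pair of the two inputs has one node more than they have together, which at most doubles the
   size; hence the factor [2 ^ d]. *)
exists B, (c * 2 ^ d), d => m n alpha I.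
have [t [Et Ht Hc]] := solution_approx alpha I.
have [time rB lt] := HB (to_input alpha I); exists t, time; split=> //.
  by rewrite Et -enc_to_input.
apply: leq_trans lt _; apply: leq_trans (Hs _) _.
rewrite -mulnA -expnMn leq_mul2l; apply/orP; right.
have le2 : vsize (enc (to_input alpha I)) <= 2 * (instance_size I + scoring_size alpha).
  rewrite enc_to_input /instance_size /scoring_size.
  rewrite mul2n -addnn [X in _ <= X + _]addnC.
  rewrite -[vsize (Pair _ _)]/((vsize (enc_scoring alpha) + vsize (enc_instance I)).+1).
  by rewrite -addn1 leq_add.
by case: (d) => [|e]; rewrite ?expn0 ?leq_exp2r.
Qed.
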